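(* There exists on $\mathbb T$ a probability $\nu\ll\mu$ such that $P_\nu$ is not hyperbounded, but $$\sum_{n\in\mathbb Z,\ n\ne0}\frac{|\hat\nu(n)|^2}{|n|}<\infty.$$
   Context: $\mathbb T$ is the circle group, identified with $[-\pi,\pi)$, with normalized Haar (Lebesgue) measure $\mu$; $L^p=L^p(\mathbb T,\mu)$. For a probability $\nu$ on $\mathbb T$, $P_\nu f(x)=\nu*f(x)=\int_{\mathbb T}f(x-y)\,d\nu(y)$, which is a contraction of every $L^p$. $P_\nu$ is hyperbounded if it maps $L^p$ into $L^q$ for some $1<p<q\le\infty$. $\hat\nu(n)=\int e^{-inx}\,d\nu(x)$, $n\in\mathbb Z$. *)

(* Defs.v *)
From HB Require Import structures.
From mathcomp Require Import all_boot all_order all_algebra.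
From mathcomp Require Import all_classical all_reals all_analysis.
From mathcomp Require Import complex.

Set Implicit Arguments.
Unset Strict Implicit.
Unset Printing Implicit Defensive.

Import Order.TTheory GRing.Theory Num.Theory.
Import numFieldNormedType.Exports.

Local Open Scope classical_set_scope.
Local Open Scope ring_scope.

(* The circle group T = R / 2 pi Z is handled through its fundamental domain
   [-pi, pi[: measures on T are measures on R carried by [-pi, pi[, functions
   on T are 2 pi-periodic functions on R, so that f (x - y) is literally the
   translate of f for the group law of T. *)

Section circle.
Variable R : realType.

Definition circle : set R := `[- pi, pi[.

Lemma ltNpipi : - pi < pi :> R.
Proof. by rewrite gtrN// pi_gt0. Qed.

(* Normalized Lebesgue measure; the endpoint pi of the support of the
   uniform distribution is a null set. *)
Definition haar : probability (measurableTypeR R) R := uniform_prob ltNpipi.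

Definition modulus (z : R[i]) : R := ComplexField.Normc.normc z.

Definition cintegral (nu : probability (measurableTypeR R) R) (f : R -> R[i]) :
    R[i] :=
  Complex (\int[nu]_(x in circle) complex.Re (f x))
          (\int[nu]_(x in circle) complex.Im (f x)).

(* Complex L^p(T, mu) with p in [1, +oo]; elements are represented by Borel
   functions. *)
Definition Lp (p : \bar R) (f : R -> R[i]) : Prop :=
  [/\ periodic f (pi *+ 2),
      measurable_fun [set: measurableTypeR R] (fun x => complex.Re (f x)),
      measurable_fun [set: measurableTypeR R] (fun x => complex.Im (f x)) &
      ('N[haar]_p[EFin \o (fun x => modulus (f x))] < +oo)%E].

(* If nu is carried by the circle and f is in L^p with p >= 1, then the
   integral converges absolutely for almost every x by Fubini's theorem; at
   the other points the value is the default one of the integral, and the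
   resulting function is still Borel. *)
Definition convolution_operator (nu : probability (measurableTypeR R) R)
    (f : R -> R[i]) : R -> R[i] :=
  fun x => cintegral nu (fun y => f (x - y)).

Definition hyperbounded (nu : probability (measurableTypeR R) R) : Prop :=
  exists (p : R) (q : \bar R),
    [/\ 1 < p, (p%:E < q)%E &
        forall f, Lp p%:E f -> Lp q (convolution_operator nu f)].

Definition expi (t : R) : R[i] := Complex (cos t) (sin t).

Definition fourier (nu : probability (measurableTypeR R) R) (n : int) : R[i] :=
  cintegral nu (fun x => expi (- (n%:~R * x))).

End circle.

Arguments circle R : clear implicits.
Arguments haar R : clear implicits.

(* Main.v *)
Require Import Defs.
From HB Require Import structures.
From mathcomp Require Import all_boot all_order all_algebra.
From mathcomp Require Import all_classical all_reals all_analysis.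
From mathcomp Require Import complex.
From mathcomp Require Import measurable_realfun ring lra.

(* Take nu = sum_k 2^-(k+1) U_k, with U_k uniform on [0, h_k], h_k = 2^-(k^2).

   Fourier side: the n-th coefficient of U_k is O(min(1, 1 / (|n| h_k))), and
   |a|^2 <= |a| when |a| <= 1, so the series is bounded by
   sum_k 2^-k sum_n min(1, 1 / (|n| h_k)) / |n|, whose inner sum is
   O(log (1 / h_k)) = O(k^2).

   Failure of hyperboundedness: let s(z) = sum_k (2^-(k+1) / h_k) 1_{|z| <= h_k}
   and f = s^(1/p), so that f is in L^p.  For - h_k / 2 <= x < 0 and
   0 <= y <= h_k / 2 one has |x - y| <= h_k, hence
   nu * f (x) >= (2^-(k+1) / h_k)^(1/p) 2^-(k+2).  The r-th power of this bound
   times h_k is 2^((r/p - 1) k^2 - O(k)), which is unbounded when r > p.  As nu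
   lives on y >= 0, the singularity of f is not met for x < 0, so that
   nu * f (x) is finite there and its value is not a default one. *)

Set Implicit Arguments.
Unset Strict Implicit.
Unset Printing Implicit Defensive.

Import Order.TTheory GRing.Theory Num.Theory.
Import numFieldNormedType.Exports.

Local Open Scope classical_set_scope.
Local Open Scope ring_scope.

(** * Harmonic sums: logarithmic growth and telescoping *)

Section harmonic.
Variable R : realFieldType.

Definition harmonic_sum n : R := \sum_(i < n) i.+1%:R^-1.

Lemma harmonic_sumS n : harmonic_sum n.+1 = harmonic_sum n + n.+1%:R^-1.
Proof. by rewrite /harmonic_sum big_ord_recr. Qed.

Lemma le_harmonic_sum m n : (m <= n)%N -> harmonic_sum m <= harmonic_sum n.
Proof.
move=> /subnK <-; elim: (n - m)%N => // d IH.
by rewrite addSn harmonic_sumS (le_trans IH)// lerDl invr_ge0.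
Qed.

(** Each of the [n] added terms is at most [1 / n]. Iterated along powers of 2, this gives the
    logarithmic growth of harmonic sums. *)
Lemma harmonic_sum_double n : (0 < n)%N ->
  harmonic_sum (n + n) <= harmonic_sum n + 1.
Proof.
move=> n0.
have H d : harmonic_sum (d + n) <= harmonic_sum n + d%:R / n%:R.
  elim: d => [|d IH]; first by rewrite mul0r addr0.
  rewrite addSn harmonic_sumS -[d.+1%:R]natr1 mulrDl addrA mul1r lerD//.
  by rewrite lef_pV2 ?posrE ?ltr0n// ler_nat leqW// leq_addl.
by rewrite (le_trans (H n))// divff// pnatr_eq0 -lt0n.
Qed.

Lemma harmonic_sum_pow2 M : harmonic_sum (2 ^ M) <= M.+1%:R.
Proof.
elim: M => [|M IH]; first by rewrite /harmonic_sum big_ord1 invr1.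
rewrite expnS mul2n -addnn (le_trans (harmonic_sum_double _)) ?expn_gt0//.
by rewrite -natr1 lerD2r.
Qed.

(** With j = i + 1, the summand is 1/j - 1/(j + K), so the sum has a closed form in harmonic sums,
    and H_n <= H_(n+K). *)
Lemma telescoping_harmonic_le K n :
  \sum_(i < n) K%:R / (i.+1%:R * (i.+1 + K)%:R) <= harmonic_sum K.
Proof.
suff -> : \sum_(i < n) K%:R / (i.+1%:R * (i.+1 + K)%:R) =
    harmonic_sum n + harmonic_sum K - harmonic_sum (n + K) :> R.
  by rewrite lerBlDr addrC lerD2l le_harmonic_sum// leq_addr.
elim: n => [|n IH].
  by rewrite big_ord0 {1}/harmonic_sum big_ord0 add0n add0r subrr.
rewrite big_ord_recr/= IH addSn !harmonic_sumS.
have n0 : n.+1%:R != 0 :> R by rewrite pnatr_eq0.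
have nK : (n + K).+1%:R != 0 :> R by rewrite pnatr_eq0.
move: nK n0; rewrite -!natr1 natrD => nK n0.
by field; rewrite n0 nK.
Qed.

End harmonic.

(** * Geometric sums and bounds on nonnegative series *)

Section geometric_sums.
Variable R : realType.

Lemma sum_half_pow n : \sum_(k < n) 2^-1 ^+ k.+1 = 1 - 2^-1 ^+ n :> R.
Proof.
elim: n => [|n IH]; first by rewrite big_ord0 expr0 subrr.
by rewrite big_ord_recr/= IH exprS; lra.
Qed.

Lemma sum_sqr_half_pow n :
  \sum_(k < n) 2^-1 ^+ k.+1 * (k ^ 2 + 2)%:R <= 5 :> R.
Proof.
(* The subtracted term is the tail of the series, whose total is 5; its quadratic factor makes the
   closed form pass the induction. *)
suff -> : \sum_(k < n) 2^-1 ^+ k.+1 * (k ^ 2 + 2)%:R =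
    5 - (n%:R ^+ 2 + 2 * n%:R + 5) * 2^-1 ^+ n :> R.
  by rewrite gerBl mulr_ge0 ?exprn_ge0// !addr_ge0 ?mulr_ge0 ?exprn_ge0.
elim: n => [|n IH]; first by rewrite big_ord0 expr0 expr0n/=; lra.
rewrite big_ord_recr/= IH -[n.+1%:R]natr1 natrD natrX.
by rewrite [2^-1 ^+ n.+1]exprS; field.
Qed.

Lemma nneseries_le_bound (u : nat -> R) M : (forall n, 0 <= u n) ->
  (forall n, \sum_(k < n) u k <= M) -> (\sum_(k <oo) (u k)%:E <= M%:E)%E.
Proof.
move=> u0 uM; apply: lime_le.
  by apply: is_cvg_nneseries => n _ _; rewrite lee_fin.
by apply: nearW => n; rewrite sumEFin big_mkord lee_fin.
Qed.

Lemma nneseries_half_pow : (\sum_(k <oo) (2^-1 ^+ k.+1 : R)%:E = 1)%E.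
Proof.
apply/cvg_lim => //.
have -> : (fun n => \sum_(0 <= k < n) (2^-1 ^+ k.+1 : R)%:E)%E =
    (fun n => (1 - 2^-1 ^+ n : R)%:E).
  by apply/funext => n; rewrite sumEFin big_mkord sum_half_pow.
apply: cvg_EFin; first exact: nearW.
rewrite -[X in _ --> X](subr0 1); apply: cvgB; first exact: cvg_cst.
by apply: cvg_expr; rewrite ger0_norm// invf_lt1// ltr1n.
Qed.

End geometric_sums.

(** The complement of [A] is null. This moves integrals between the circle, [0, 1] and the whole
    line. *)
Lemma ge0_integral_carrier (R : realType) d (T : measurableType d)
    (P : probability T R) (A : set T) (f : T -> \bar R) :
  measurable A -> P A = 1%E ->
  measurable_fun setT f -> (forall x, 0 <= f x)%E ->
  (\int[P]_(x in A) f x = \int[P]_x f x)%E.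
Proof.
move=> mA A1 mf f0.
have PA : P (~` A) = 0%E by rewrite probability_setC// A1 subee.
rewrite [RHS](@ge0_negligible_integral _ _ _ _ _ (~` A))//.
- by rewrite setTD setCK.
- exact: measurableC.
Qed.

(** * The measure nu: mass, support, absolute continuity and integration *)

Section mixture.
Variable R : realType.

Definition weight k : R := 2^-1 ^+ k.+1.
Definition width k : R := 2^-1 ^+ (k ^ 2).

Lemma weight_gt0 k : 0 < weight k. Proof. by rewrite exprn_gt0// invr_gt0. Qed.

Lemma weight_ge0 k : 0 <= weight k. Proof. exact/ltW/weight_gt0. Qed.

Lemma width_gt0 k : 0 < width k. Proof. by rewrite exprn_gt0// invr_gt0. Qed.

Lemma width_le1 k : width k <= 1.
Proof. by rewrite exprn_ile1// invf_le1// ler1n. Qed.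

Definition mixture : set (measurableTypeR R) -> \bar R :=
  mseries (fun k => mscale (NngNum (weight_ge0 k))
                      (uniform_prob (width_gt0 k))) 0.

HB.instance Definition _ := Measure.on mixture.

Lemma mixtureE A : mixture A =
  (\sum_(k <oo) (weight k)%:E * uniform_prob (width_gt0 k) A)%E.
Proof. by []. Qed.

Let mixture_setT : mixture setT = 1%E.
Proof.
rewrite mixtureE; under eq_eseriesr do rewrite probability_setT mule1.
exact: nneseries_half_pow.
Qed.

HB.instance Definition _ :=
  Measure_isProbability.Build _ _ R mixture mixture_setT.

Lemma mixture_supp : mixture `[0, 1] = 1%E.
Proof.
rewrite mixtureE -[RHS]nneseries_half_pow; apply: eq_eseriesr => k _.
rewrite /uniform_prob integral_uniform_pdf1 ?mule1 ?width_gt0//.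
move=> x /=; rewrite !in_itv/= => /andP[-> xk].
exact: le_trans xk (width_le1 k).
Qed.

Lemma unit_itv_circle : `[0, 1] `<=` circle R.
Proof.
move=> x; rewrite /circle/= !in_itv/= => /andP[x0 x1].
have p2 := pi_ge2 R; rewrite (le_trans _ x0) ?oppr_le0 ?pi_ge0//=.
by rewrite (le_lt_trans x1)// (lt_le_trans _ p2)// ltr1n.
Qed.

Lemma measurable_circle : measurable (circle R : set (measurableTypeR R)).
Proof. exact: measurable_itv. Qed.

Lemma mixture_circle : mixture (circle R) = 1%E.
Proof.
apply/eqP; rewrite eq_le probability_le1/=; last exact: measurable_circle.
rewrite -mixture_supp le_measure ?inE//.
- exact: measurable_circle.
- exact: unit_itv_circle.
Qed.

Lemma mixture_dominated : mixture `<< haar R.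
Proof.
apply/null_content_dominatesP => A mA A0.
rewrite mixtureE eseries0// => k _ _.
suff -> : uniform_prob (width_gt0 k) A = 0%E by rewrite mule0.
apply/eqP; rewrite eq_le measure_ge0 andbT.
move: A0; rewrite /haar /uniform_prob/= => A0.
(* This constant is the ratio of the densities of U_k and of [haar] on [0, h_k], so U_k is dominated
   by that multiple of [haar]. *)
have c0 : 0 < (width k)^-1 * (pi + pi) :> R.
  by rewrite mulr_gt0 ?invr_gt0 ?width_gt0// addr_gt0 ?pi_gt0.
rewrite -[leRHS](mule0 ((width k)^-1 * (pi + pi))%:E) -A0 -ge0_integralZl//.
- apply: ge0_le_integral => //.
  + by move=> x _; rewrite lee_fin uniform_pdf_ge0// width_gt0.
  + apply/measurable_EFinP/measurable_funTS; exact: measurable_uniform_pdf.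
  + apply/measurable_EFinP/measurable_funTS/measurable_funM => //.
    exact: measurable_uniform_pdf.
  + move=> x _; rewrite -EFinM lee_fin /uniform_pdf.
    case: ifPn => [/andP[x0 x1]|_]; last first.
      rewrite mulr_ge0 ?(ltW c0)//; case: ifPn => // _.
      by rewrite invr_ge0 opprK addr_ge0 ?pi_ge0.
    have := pi_ge2 R; have := width_le1 k => w1 p2.
    rewrite ifT; last by apply/andP; split; lra.
    rewrite opprK -mulrA divff ?mulr1 ?subr0//.
    by rewrite gt_eqF// addr_gt0 ?pi_gt0.
- by apply/measurable_EFinP/measurable_funTS; exact: measurable_uniform_pdf.
- by move=> x _; rewrite lee_fin uniform_pdf_ge0// ltNpipi.
- exact: ltW.
Qed.

Lemma ge0_integral_mixture (A : set R) (f : R -> \bar R) :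
  measurable A -> mixture A = 1%E ->
  measurable_fun [set: measurableTypeR R] f -> (forall x, 0 <= f x)%E ->
  (\int[mixture]_(x in A) f x = \sum_(k <oo) (weight k / width k)%:E *
    \int[lebesgue_measure]_(x in `[0%R, width k]) f x)%E.
Proof.
move=> mA A1 mf f0; rewrite ge0_integral_carrier//.
rewrite ge0_integral_measure_series//; apply: eq_eseriesr => k _.
rewrite ge0_integral_mscale//= integral_uniform// subr0.
by rewrite muleA EFinM.
Qed.

End mixture.

(** Positive and negative integers are enumerated by [Posz n.+1] and [Negz n]; both have absolute
    value [n.+1], hence two equal series. *)
Lemma esum_nonzero_int (R : realType) (a : nat -> \bar R) :
  (forall n, 0 <= a n)%E ->
  (\esum_(n in [set n : int | n != 0%R]) a `|n|%N =
   \sum_(n <oo) a n.+1 + \sum_(n <oo) a n.+1)%E.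
Proof.
move=> a0; rewrite (esumID [set n : int | 0 < n])//; congr (_ + _)%E.
- rewrite [X in esum X _](_ : _ = (fun n => Posz n.+1) @` xpredT).
    by rewrite (esum_pred_image (fun n => a `|n|%N))// => m n _ _ [].
  apply/seteqP; split => [|_ [n _ <-]//].
  by move=> [[|n]|n] [] //= _ _; exists n.
- rewrite [X in esum X _](_ : _ = (fun n => Negz n) @` xpredT).
    by rewrite (esum_pred_image (fun n => a `|n|%N))// => m n _ _ [].
  apply/seteqP; split => [|_ [n _ <-]//].
  by move=> [[|n]|n] [] //= _ nn; exists n.
Qed.

(** * Bounds on Fourier coefficients through bounded primitives *)

Section oscillation.
Variable R : realType.
Implicit Types phi Phi : R -> R.

Lemma integrable_mixture phi : measurable_fun [set: measurableTypeR R] phi ->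
  (forall x, `|phi x| <= 1) ->
  (@mixture R).-integrable (circle R) (EFin \o phi).
Proof.
move=> mphi phi1; have mcphi := measurable_funTS (D := circle R) mphi.
have mufin : (mixture (circle R) < +oo)%E by rewrite mixture_circle ltry.
apply: (measurable_bounded_integrable (@measurable_circle R) mufin mcphi).
by exists 1; split => // x x1 y _; exact: le_trans (phi1 y) (ltW x1).
Qed.

(* 1 + phi is nonnegative, so the integral against the series of measures can
   be computed termwise without discussing integrability. *)
Lemma mixture_oscillation_le phi Phi (D : R) : continuous phi ->
  (forall x, `|phi x| <= 1) ->
  (forall x : R, is_derive x 1 Phi (phi x)) ->
  (forall h, Phi h - Phi 0 <= D) ->
  ((\int[@mixture R]_(x in circle R) phi x)%:E <=
   \sum_(k <oo) (weight R k * Num.min 1 (D / width R k))%:E)%E.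
Proof.
move=> cphi phi1 dPhi PhiD.
have mphi : measurable_fun [set: measurableTypeR R] phi.
  exact: continuous_measurable_fun.
have iphi := integrable_mixture mphi phi1.
have i1 : (@mixture R).-integrable (circle R) (EFin \o cst (1 : R)).
  by apply: integrable_mixture => // x; rewrite normr1.
(* The bound on [Phi h - Phi 0] is taken at h = 0. *)
have D0 : 0 <= D by rewrite -(subrr (Phi 0)).
have phi_ge x : 0 <= 1 + phi x.
  by rewrite addrC -lerBlDr sub0r; have := phi1 x; rewrite ler_norml => /andP[].
have h0 k := width_gt0 R k.
have w0 k := weight_ge0 R k.
rewrite -(leeD2lE (x := 1%E))//.
have -> : (1 + (\int[@mixture R]_(x in circle R) phi x)%:E =
    \int[@mixture R]_(x in circle R) (1 + phi x)%:E)%E.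
  have := RintegralD (@measurable_circle R) i1 iphi.
  rewrite Rintegral_cst/=; last exact: measurable_circle.
  rewrite mixture_circle mulr1 -EFinD => <-.
  rewrite fineK// integrable_fin_num//.
    exact: measurable_circle.
  exact: (integrableD (@measurable_circle R) i1 iphi).
rewrite ge0_integral_mixture//; last 3 first.
- exact: measurable_circle.
- exact: mixture_circle.
- by apply/measurable_EFinP/measurable_funD.
rewrite -[X in (X + _)%E](nneseries_half_pow R) -nneseriesD; last 2 first.
- by move=> k _; rewrite lee_fin.
- by move=> k _; rewrite lee_fin mulr_ge0// le_min ler01 divr_ge0// ltW.
apply: lee_nneseries => [k _ _|k _].
  apply: mule_ge0; first by rewrite lee_fin divr_ge0// ltW.
  by apply: integral_ge0 => x _; rewrite lee_fin.
rewrite -EFinD -[X in (_ <= (X + _)%:E)%E](mulr1 (weight R k)) -mulrDr.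
have -> : weight R k * (1 + Num.min 1 (D / width R k)) =
    weight R k / width R k * (width R k * (1 + Num.min 1 (D / width R k))).
  by rewrite mulrA divfK// gt_eqF.
rewrite [leRHS]EFinM lee_wpmul2l ?lee_fin ?divr_ge0 ?(ltW (h0 k))//.
(* If the minimum is 1, the pointwise bound [1 + phi x <= 2] suffices. Otherwise the integral is
   computed from the primitive [x + Phi x], whose oscillating part contributes at most [D]. *)
rewrite minEle mulrDr mulr1; case: ifPn => _.
  rewrite mulr1.
  apply: (@le_trans _ _
      (\int[lebesgue_measure]_(x in `[0%R, width R k]) 2%:E)%E).
    apply: ge0_le_integral => //.
    - by move=> x _; rewrite lee_fin.
    - by apply/measurable_EFinP/measurable_funTS/measurable_funD.
    - move=> x _; rewrite lee_fin (natrD _ 1 1) lerD2l.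
      by have := phi1 x; rewrite ler_norml => /andP[].
  rewrite integral_cst//= lebesgue_measure_itv/= lte_fin h0 -EFinD -EFinM.
  rewrite lee_fin.
  by rewrite subr0 mulr_natl mulr2n.
have -> : (\int[lebesgue_measure]_(x in `[0%R, width R k]) (1 + phi x)%:E =
    (width R k + (Phi (width R k) - Phi 0))%:E)%E.
  rewrite (@continuous_FTC2 _ _ (fun x => x + Phi x))//.
  - by rewrite -EFinB; congr EFin; ring.
  - apply: continuous_subspaceT => x; apply: cvgD; [exact: cvg_cst|exact: cphi].
  - have dF (x : R) : is_derive x 1 (fun x => x + Phi x) (1 + phi x).
      exact: is_deriveD.
    have cF (x : R) : {for x, continuous (fun x => x + Phi x)}.
      by apply: differentiable_continuous; apply/derivable1_diffP; case: (dF x).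
    split.
    + by move=> x _; case: (dF x).
    + by apply: cvg_at_right_filter; exact: cF.
    + by apply: cvg_at_left_filter; exact: cF.
  - move=> x _; rewrite derive1E.
    by case: (is_deriveD (is_derive_id x 1) (dPhi x)).
by rewrite lee_fin lerD2l mulrC divfK ?gt_eqF.
Qed.

(** The one-sided bound is applied to [phi] or to [- phi], according to the sign of the integral. *)
Lemma mixture_oscillation phi Phi (D : R) : continuous phi ->
  (forall x, `|phi x| <= 1) ->
  (forall x : R, is_derive x 1 Phi (phi x)) ->
  (forall h, `|Phi h - Phi 0| <= D) ->
  (`|\int[@mixture R]_(x in circle R) phi x|%:E <=
   \sum_(k <oo) (weight R k * Num.min 1 (D / width R k))%:E)%E.
Proof.
move=> cphi phi1 dPhi PhiD.
have mphi : measurable_fun [set: measurableTypeR R] phi.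
  exact: continuous_measurable_fun.
have [/ger0_norm ->|/ltW/ler0_norm ->] :=
    leP 0 (\int[@mixture R]_(x in circle R) phi x).
  apply: (mixture_oscillation_le cphi phi1 dPhi) => h.
  exact: le_trans (ler_norm _) _.
have -> : - (\int[@mixture R]_(x in circle R) phi x) =
    \int[@mixture R]_(x in circle R) - phi x.
  rewrite -mulN1r -RintegralZl//.
  - by apply: eq_Rintegral => x _; rewrite mulN1r.
  - exact: measurable_circle.
  - exact: integrable_mixture.
apply: (@mixture_oscillation_le _ (fun x => - Phi x)) => //.
- by move=> x; apply: cvgN; exact: cphi.
- by move=> x; rewrite normrN.
- by move=> h; rewrite opprK addrC -opprB (le_trans (ler_norm _))// normrN.
Qed.

Lemma Re_fourier_le (n : int) : n != 0 ->
  (`|complex.Re (fourier (@mixture R) n)|%:E <= \sum_(k <oo)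
     (weight R k * Num.min 1 (2 / (`|n|%N)%:R / width R k))%:E)%E.
Proof.
move=> n0; have nR : n%:~R != 0 :> R by rewrite intr_eq0.
have nN : `|n%:~R : R| = (`|n|%N)%:R by rewrite -intr_norm -abszE.
apply: (@mixture_oscillation _ (fun x => sin (n%:~R * x) / n%:~R)).
- move=> x; apply: continuous_comp; last exact: continuous_cos.
  by apply: cvgN; apply: cvgM; [exact: cvg_cst|exact: cvg_id].
- by move=> x; rewrite ler_norml cos_geN1 cos_le1.
- move=> x; rewrite /expi/= cosN; apply: is_derive_eq.
  by rewrite !scaler0 add0r /GRing.scale/= mulr1; field.
(* The bound 1 on the sine is relaxed to 2, so that real and imaginary parts share one majorant. *)
- move=> h; rewrite mulr0 sin0 mul0r subr0 normrM normfV nN ler_wpM2r//.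
  by rewrite (le_trans _ (ler1n _ 2))// ler_norml sin_geN1 sin_le1.
Qed.

Lemma Im_fourier_le (n : int) : n != 0 ->
  (`|complex.Im (fourier (@mixture R) n)|%:E <= \sum_(k <oo)
     (weight R k * Num.min 1 (2 / (`|n|%N)%:R / width R k))%:E)%E.
Proof.
move=> n0; have nR : n%:~R != 0 :> R by rewrite intr_eq0.
have nN : `|n%:~R : R| = (`|n|%N)%:R by rewrite -intr_norm -abszE.
apply: (@mixture_oscillation _ (fun x => cos (n%:~R * x) / n%:~R)).
- move=> x; apply: continuous_comp; last exact: continuous_sin.
  by apply: cvgN; apply: cvgM; [exact: cvg_cst|exact: cvg_id].
- by move=> x; rewrite ler_norml sin_geN1 sin_le1.
- move=> x; rewrite /expi/= sinN; apply: is_derive_eq.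
  by rewrite !scaler0 add0r /GRing.scale/= mulr1; field.
(* The primitive is 1/n at 0, so the numerator is [cos - 1], of absolute value at most 2. *)
- move=> h; rewrite mulr0 cos0 -mulrBl normrM normfV nN ler_wpM2r//.
  have := cos_geN1 (n%:~R * h); have := cos_le1 (n%:~R * h).
  by rewrite ler_norml; lra.
Qed.

End oscillation.

(** * Convergence of the weighted Fourier series *)

Section fourier_sum.
Variable R : realType.

(* With K = 2^(k^2+1), min(1, K/m) is replaced by the comparable 2K/(m+K),
   because K/(m(m+K)) = 1/m - 1/(m+K) telescopes. *)
Definition fourier_majorant k m : R :=
  weight R k * ((2 ^ (k ^ 2).+1)%:R / (m%:R * (m + 2 ^ (k ^ 2).+1)%:R)).

Lemma fourier_majorant_ge0 k m : 0 <= fourier_majorant k m.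
Proof. by rewrite mulr_ge0 ?weight_ge0// divr_ge0// mulr_ge0. Qed.

(** If m <= K, then m + K <= 2K and the right side is at least 1; if K <= m, then m + K <= 2m and it
    is at least K/m. *)
Lemma min1_div_le (K m : nat) : (0 < m)%N ->
  Num.min 1 (K%:R / m%:R) <= 2 * K%:R / (m + K)%:R :> R.
Proof.
move=> m0; have m0R : 0 < m%:R :> R by rewrite ltr0n.
have K0 : 0 <= K%:R :> R by [].
have mK : 0 < (m + K)%:R :> R by rewrite ltr0n addn_gt0 m0.
rewrite ge_min; have [mleK|/ltW Klem] := leP (m%:R : R) K%:R.
  by rewrite ler_pdivlMr// natrD; apply/orP; left; lra.
apply/orP; right; rewrite ler_pdivrMr// mulrAC ler_pdivlMr//.
rewrite natrD; nra.
Qed.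

Lemma weight_min_le k m : (0 < m)%N ->
  weight R k * Num.min 1 (2 / m%:R / width R k) / m%:R <=
  2 * fourier_majorant k m.
Proof.
move=> m0; have m0R : 0 < m%:R :> R by rewrite ltr0n.
(* Here K = 2^(k^2+1) appears, as 2 / h_k. *)
have -> : 2 / m%:R / width R k = (2 ^ (k ^ 2).+1)%:R / m%:R :> R.
  by rewrite /width exprVn invrK (expnS 2) natrM natrX mulrAC.
rewrite /fourier_majorant -mulrA [leRHS]mulrCA ler_wpM2l ?weight_ge0//.
rewrite ler_pdivrMr// (le_trans (min1_div_le _ m0))//.
rewrite le_eqVlt; apply/orP; left; apply/eqP; field.
by rewrite -natrD !pnatr_eq0 addn_eq0 negb_and -!lt0n m0.
Qed.

(** Real and imaginary parts are both at most S in absolute value, and S <= 1 because the weights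
    sum to 1. So each square is at most S, which gives 2S; comparing the minimum with
    [fourier_majorant] costs another factor 2. *)
Lemma fourier_term_le (n : int) : n != 0 ->
  ((modulus (fourier (@mixture R) n) ^+ 2 / `|n|%:~R)%:E <=
   \sum_(k <oo) (4 * fourier_majorant k `|n|%N)%:E)%E.
Proof.
move=> n0; have m0 : (0 < `|n|)%N by rewrite absz_gt0.
have m0R : 0 < (`|n|%N)%:R :> R by rewrite ltr0n.
set S := (\sum_(k <oo) (weight R k *
  Num.min 1 (2 / (`|n|%N)%:R / width R k))%:E)%E.
have T0 k : 0 <= weight R k * Num.min 1 (2 / (`|n|%N)%:R / width R k).
  by rewrite mulr_ge0 ?weight_ge0// le_min ler01 !divr_ge0// ltW ?width_gt0.
have S0 : (0 <= S)%E by apply: nneseries_ge0 => k _ _; rewrite lee_fin.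
have S1 : (S <= 1)%E.
  rewrite -(nneseries_half_pow R); apply: lee_nneseries => k _;
    rewrite lee_fin//.
  by rewrite ler_piMr ?weight_ge0// ge_min lexx.
have Sfin : S \is a fin_num by rewrite ge0_fin_numE// (le_lt_trans S1) ?ltry.
have := Re_fourier_le R n0; have := Im_fourier_le R n0; rewrite -/S.
move: S1 S0; rewrite -(fineK Sfin) !lee_fin => S1 S0 Im_le Re_le.
have modE : modulus (fourier (@mixture R) n) ^+ 2 =
    `|complex.Re (fourier (@mixture R) n)| ^+ 2 +
    `|complex.Im (fourier (@mixture R) n)| ^+ 2.
  rewrite /modulus; case: (fourier _ _) => a b /=.
  by rewrite sqr_sqrtr ?addr_ge0 ?sqr_ge0// !real_normK ?num_real.
have sqr_le (x : R) : `|x| <= fine S -> `|x| ^+ 2 <= fine S.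
  move=> xS; rewrite expr2 (le_trans _ xS)// ler_piMr//.
  exact: le_trans xS S1.
apply: (@le_trans _ _ ((2 / (`|n|%N)%:R)%:E * S)%E).
  rewrite -(fineK Sfin) -EFinM lee_fin.
  have -> : (`|n|%:~R : R) = (`|n|%N)%:R by rewrite -abszE.
  rewrite [leRHS]mulrAC ler_wpM2r ?invr_ge0// modE mulr_natl mulr2n.
  by rewrite lerD// sqr_le.
rewrite -nneseriesZl; last by move=> k _; rewrite lee_fin.
apply: lee_nneseries => [k _ _|k _].
  by rewrite mule_ge0 ?lee_fin// divr_ge0.
rewrite -EFinM lee_fin.
by have := weight_min_le k m0; set t := Num.min _ _; lra.
Qed.

(** Telescoping leaves the harmonic sum up to 2^(k^2+1), which the doubling argument bounds by k^2 +
    2. *)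
Lemma fourier_majorant_sum k :
  (\sum_(m <oo) (fourier_majorant k m.+1)%:E <=
   (weight R k * (k ^ 2 + 2)%:R)%:E)%E.
Proof.
apply: nneseries_le_bound => [n|n]; first exact: fourier_majorant_ge0.
rewrite -mulr_sumr ler_wpM2l ?weight_ge0//.
rewrite (le_trans (telescoping_harmonic_le _ _ _))//.
by rewrite (le_trans (harmonic_sum_pow2 _ _))// addn2.
Qed.

Lemma fourier_sum_finite :
  (\esum_(n in [set n : int | n != 0%R])
     (modulus (fourier (@mixture R) n) ^+ 2 / `|n|%:~R)%:E < +oo)%E.
Proof.
pose a m := (\sum_(k <oo) (4 * fourier_majorant k m)%:E)%E.
have F0 k m : (0 <= (4 * fourier_majorant k m)%:E)%E.
  by rewrite lee_fin mulr_ge0// fourier_majorant_ge0.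
apply: (@le_lt_trans _ _ (\esum_(n in [set n : int | n != 0%R]) a `|n|%N)%E).
  apply: le_esum => n n0; apply: fourier_term_le n0.
rewrite esum_nonzero_int; last first.
  by move=> m; apply: nneseries_ge0 => k _ _.
(* Both halves of the sum over the integers are this series. After exchanging the sums, 20 is 4
   times the bound 5 on the sum of 2^-(k+1) (k^2 + 2). *)
suff H : (\sum_(m <oo) a m.+1 <= 20%:E)%E.
  by apply: lte_add_pinfty; apply: (le_lt_trans H); rewrite ltry.
rewrite nneseries_interchange//.
apply: (@le_trans _ _ (\sum_(k <oo) (4 * (weight R k * (k ^ 2 + 2)%:R))%:E)%E).
  apply: lee_nneseries => [k _ _|k _].
    by apply: nneseries_ge0 => m _ _.
  under eq_eseriesr do rewrite EFinM.
  rewrite nneseriesZl; last by move=> m _; rewrite lee_fin fourier_majorant_ge0.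
  by rewrite EFinM lee_wpmul2l ?lee_fin// fourier_majorant_sum.
apply: nneseries_le_bound => [k|n].
  by rewrite !mulr_ge0 ?weight_ge0.
have -> : 20 = 4 * 5 :> R by ring.
by rewrite -mulr_sumr ler_wpM2l// sum_sqr_half_pow.
Qed.

End fourier_sum.

(** * The singular function s and the test function s^(1/p) *)

Section spike.
Variable R : realType.
Local Notation weight := (weight R).
Local Notation width := (width R).

(** Cosine is even and strictly decreasing on [0, pi]. *)
Lemma le_cos_cos (h z : R) : 0 <= h <= pi -> `|z| <= pi ->
  (cos h <= cos z) = (`|z| <= h).
Proof.
move=> hpi zpi; have -> : cos z = cos `|z|.
  by case: (ger0P z) => // _; rewrite cosN.
by rewrite !leNgt ltr_cos// !in_itv//= normr_ge0.
Qed.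

Definition density_height k : R := weight k / width k.

Lemma density_height_gt0 k : 0 < density_height k.
Proof. by rewrite divr_gt0 ?weight_gt0 ?width_gt0. Qed.

Lemma width_itv k : 0 <= width k <= pi.
Proof.
rewrite ltW ?width_gt0//= (le_trans (width_le1 R k))//.
by rewrite (le_trans _ (pi_ge2 R))// ler1n.
Qed.

(* On [-pi, pi] the condition says |z| <= width k; through cos it becomes
   2 pi-periodic. *)
Definition spike_term k (z : R) : R :=
  density_height k * (cos (width k) <= cos z)%R%:R.

Lemma spike_term_ge0 k z : 0 <= spike_term k z.
Proof. by rewrite mulr_ge0// ltW ?density_height_gt0. Qed.

(** Extended values are needed: at 0 every term is active and the series diverges. *)
Definition spike (z : R) : \bar R := (\sum_(k <oo) (spike_term k z)%:E)%E.

Lemma spike_ge0 z : (0 <= spike z)%E.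
Proof. by apply: nneseries_ge0 => k _ _; rewrite lee_fin spike_term_ge0. Qed.

Lemma spikeD2pi z : spike (z + pi *+ 2) = spike z.
Proof.
by apply: eq_eseriesr => k _; rewrite /spike_term cosD2pi.
Qed.

Lemma measurable_spike_term k :
  measurable_fun [set: measurableTypeR R] (spike_term k).
Proof.
apply: measurable_funM => //.
have -> : (fun z : measurableTypeR R => (cos (width k) <= cos z)%R%:R) =
    \1_[set z | cos (width k) <= cos z] :> (_ -> R).
  by apply/funext => z; rewrite indicE mem_setE.
apply: measurable_indic.
rewrite [X in measurable X](_ : _ = cos @^-1` `[cos (width k), +oo[).
  rewrite -[X in measurable X]setTI.
  by apply: continuous_measurable_fun => //; exact: continuous_cos.
by apply/seteqP; split => z /=; rewrite in_itv/= andbT.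
Qed.

Lemma measurable_spike : measurable_fun [set: measurableTypeR R] spike.
Proof.
apply: ge0_emeasurable_sum => k.
- by move=> z _ _; rewrite lee_fin spike_term_ge0.
- by move=> _; apply/measurable_EFinP; exact: measurable_spike_term.
Qed.

(** An active term has [|z| <= width k], so its height is at most [weight k / |z|]; the weights sum
    to 1. *)
Lemma spike_le (z : R) : z != 0 -> `|z| <= pi -> (spike z <= (`|z|^-1)%:E)%E.
Proof.
move=> z0 zpi; have z_gt0 : 0 < `|z| by rewrite normr_gt0.
apply: (@le_trans _ _ (\sum_(k <oo) (`|z|^-1)%:E * (2^-1 ^+ k.+1)%:E)%E).
  apply: lee_nneseries => [k _ _|k _]; first by rewrite lee_fin spike_term_ge0.
  rewrite -EFinM lee_fin /spike_term le_cos_cos ?width_itv//.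
  have [zk|_] := leP `|z| (width k); last by rewrite mulr0 mulr_ge0 ?invr_ge0.
  rewrite mulr1 /density_height mulrC ler_wpM2r ?weight_ge0//.
  by rewrite lef_pV2 ?posrE ?width_gt0.
rewrite nneseriesZl; last by move=> k _; rewrite lee_fin.
by rewrite nneseries_half_pow mule1.
Qed.

Lemma spike_fin_num (z : R) : z != 0 -> `|z| <= pi -> spike z \is a fin_num.
Proof.
move=> z0 zpi; rewrite ge0_fin_numE ?spike_ge0//.
by rewrite (le_lt_trans (spike_le z0 zpi))// ltry.
Qed.

Lemma density_height_le_spike k (z : R) : `|z| <= width k ->
  ((density_height k)%:E <= spike z)%E.
Proof.
move=> zk; have zpi : `|z| <= pi.
  by rewrite (le_trans zk)//; have /andP[] := width_itv k.
rewrite /spike (@nneseriesD1 _ _ k)//; last first.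
  by move=> i _; rewrite lee_fin spike_term_ge0.
rewrite {1}/spike_term le_cos_cos ?width_itv// zk mulr1 leeDl//.
by apply: nneseries_ge0 => i _ _; rewrite lee_fin spike_term_ge0.
Qed.

Lemma integral_haar (f : R -> \bar R) :
  measurable_fun [set: measurableTypeR R] f -> (forall x, 0 <= f x)%E ->
  (\int[haar R]_x f x =
   ((pi + pi)^-1)%:E * \int[lebesgue_measure]_(x in `[(- pi)%R, pi]) f x)%E.
Proof. by move=> mf f0; rewrite integral_uniform// opprK. Qed.

(** The k-th term has height [weight k / width k] on an interval of length [2 * width k], so it
    contributes at most [weight k / pi <= weight k]. *)
Lemma integral_spike : (\int[haar R]_x spike x <= 1)%E.
Proof.
have pp : 0 < pi + pi :> R by rewrite addr_gt0 ?pi_gt0.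
rewrite integral_nneseries//=; last 2 first.
- by move=> k; apply/measurable_EFinP; exact: measurable_spike_term.
- by move=> k z _; rewrite lee_fin spike_term_ge0.
rewrite -(nneseries_half_pow R); apply: lee_nneseries => [k _ _|k _].
  by apply: integral_ge0 => z _; rewrite lee_fin spike_term_ge0.
rewrite integral_haar; last 2 first.
- by apply/measurable_EFinP; exact: measurable_spike_term.
- by move=> z; rewrite lee_fin spike_term_ge0.
under eq_integral => z.
  rewrite inE/= in_itv/= -ler_norml => zpi.
  rewrite /spike_term le_cos_cos ?width_itv// EFinM.
  have -> : (`|z| <= width k) = (z \in `[- width k, width k]%classic).
    by rewrite mem_setE in_itv/= -ler_norml.
  rewrite -indicE; over.
rewrite ge0_integralZl//; last 2 first.
- by apply/measurable_EFinP/measurable_funTS; exact: measurable_indic.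
- by rewrite lee_fin ltW ?density_height_gt0.
rewrite integral_indic//.
have hI : (0 <= (density_height k)%:E)%E.
  by rewrite lee_fin ltW ?density_height_gt0.
have pI : (0 <= ((pi + pi)^-1 : R)%:E)%E by rewrite lee_fin invr_ge0 ltW.
apply: (le_trans (lee_wpmul2l pI (lee_wpmul2l hI (measureIl _ _ _)))) => //.
have w0 := width_gt0 R k.
rewrite /= lebesgue_measure_itv/= lte_fin gtrN// -EFinD -!EFinM lee_fin opprK.
have -> : (pi + pi)^-1 * (density_height k * (width k + width k)) =
    weight k / pi.
  rewrite /density_height; move: (pi_gt0 R); generalize (pi : R) => P P0.
  by field; rewrite !lt0r_neq0// addr_gt0.
rewrite ler_pdivrMr ?pi_gt0// ler_peMr ?weight_ge0//.
by rewrite (le_trans _ (pi_ge2 R))// ler1n.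
Qed.

(** [fine] replaces the infinite value of [spike] on 2 pi Z by 0. *)
Definition test_function (p : R) (z : R) : R[i] :=
  Complex (fine (spike z) `^ p^-1) 0.

Lemma modulus_real (a : R) : modulus (Complex a 0) = `|a|.
Proof. by rewrite /modulus/= expr0n/= addr0 sqrtr_sqr. Qed.

Lemma measurable_test_function p : measurable_fun [set: measurableTypeR R]
  (fun z => complex.Re (test_function p z)).
Proof.
apply: (measurableT_comp (measurable_powR p^-1)).
apply: (measurableT_comp (f := fine)); first exact: fine_measurable.
exact: measurable_spike.
Qed.

Lemma Lp_test_function (p : R) : 1 < p -> Lp p%:E (test_function p).
Proof.
move=> p1; have p0 : 0 < p by rewrite (lt_trans _ p1).
split.
- by move=> z; rewrite /test_function spikeD2pi.
- exact: measurable_test_function.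
- exact: measurable_cst.
(* The p-th power undoes the root, and [fine (spike z)] is at most [spike z], also where the latter
   is infinite. *)
have powE z : (`|(modulus (test_function p z))%:E| `^ p =
    (fine (spike z))%:E)%E.
  rewrite /test_function modulus_real abse_EFin normr_id ger0_norm ?powR_ge0//.
  rewrite poweR_EFin -powRrM mulVf ?gt_eqF// powRr1 ?fine_ge0 ?spike_ge0//.
rewrite unlock; apply: poweR_lty.
apply: (@le_lt_trans _ _ 1%E); last exact: ltry.
under eq_integral do rewrite powE.
apply: le_trans integral_spike; apply: ge0_le_integral => //.
- by move=> z _; rewrite lee_fin fine_ge0 ?spike_ge0.
- apply/measurable_EFinP; apply: measurableT_comp; first exact: fine_measurable.
  exact: measurable_spike.
- exact: measurable_spike.
- move=> z _ /=; have := spike_ge0 z; case: (spike z) => //= _; exact: leey.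
Qed.

End spike.

(** * Failure of hyperboundedness *)

Section not_hyperbounded.
Variable R : realType.
Local Notation weight := (weight R).
Local Notation width := (width R).
Local Notation density_height := (density_height R).

(** The component U_k alone gives half of its mass to this interval. *)
Lemma mixture_half_width k :
  ((weight k / 2)%:E <= mixture (`[0%R, (width k / 2)%R]%classic : set R))%E.
Proof.
have w0 := width_gt0 R k; rewrite mixtureE (@nneseriesD1 _ _ k)//; last first.
  by move=> i _; rewrite mule_ge0// lee_fin weight_ge0.
have -> : uniform_prob (width_gt0 R k) `[0%R, (width k / 2)%R]%classic =
    (2^-1)%:E.
  rewrite /uniform_prob; under eq_integral => x.
    rewrite inE/= in_itv/= => /andP[x0 xw].
    rewrite /uniform_pdf ifT ?subr0; last by apply/andP; split; lra.
    over.
  rewrite integral_cst//= lebesgue_measure_itv/= lte_fin divr_gt0// sube0.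
  by rewrite -EFinM mulrA mulVf ?mul1r// gt_eqF.
rewrite -EFinM leeDl//; apply: nneseries_ge0 => i _ _.
by rewrite mule_ge0// lee_fin weight_ge0.
Qed.

Lemma convolution_test_function_ge (p x : R) k : 0 < p ->
  - (width k / 2) <= x < 0 ->
  density_height k `^ p^-1 * (weight k / 2) <=
  complex.Re (convolution_operator (@mixture R) (test_function p) x).
Proof.
move=> p0 /andP[xk x0]; have wk := width_gt0 R k; have wk1 := width_le1 R k.
have p2 := pi_ge2 R; have ip0 : 0 <= p^-1 by rewrite invr_ge0 ltW.
pose g z := complex.Re (test_function p z).
have g0 z : 0 <= g z by exact: powR_ge0.
have mg : measurable_fun [set: measurableTypeR R] (fun y => (g (x - y))%:E).
  apply/measurable_EFinP.
  apply: (measurableT_comp (f := g)); first exact: measurable_test_function.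
  exact: measurable_funB.
have gE0 y : (0 <= (g (x - y))%:E)%E by rewrite lee_fin.
have carrierE (A : set (measurableTypeR R)) :
    measurable A -> mixture A = 1%E ->
    (\int[@mixture R]_(y in A) (g (x - y))%:E =
     \int[@mixture R]_y (g (x - y))%:E)%E.
  by move=> mA A1; apply: ge0_integral_carrier.
(* Integration over the circle becomes integration over [0, 1], where x - y stays negative. *)
have IE := etrans (carrierE _ (@measurable_circle R) (mixture_circle R))
  (esym (carrierE _ (measurable_itv _) (mixture_supp R))).
have -> : complex.Re (convolution_operator (@mixture R) (test_function p) x) =
    fine (\int[@mixture R]_(y in `[0%R, 1%R]) (g (x - y))%:E)%E.
  exact: (congr1 fine IE).
have zE y : 0 <= y -> y <= 1 ->
    [/\ x - y != 0, `|x - y| <= pi & `|x - y| = y - x].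
  move=> y0 y1; have xy : x - y < 0 by lra.
  by rewrite ltr0_norm// opprB; split; [rewrite lt_eqF|lra|].
(* An infinite integral would be read as 0. It is finite since |x - y| >= -x > 0, so that [spike_le]
   bounds the integrand by a constant. *)
have fin : (\int[@mixture R]_(y in `[0%R, 1%R]) (g (x - y))%:E)%E \is a fin_num.
  rewrite ge0_fin_numE; last by apply: integral_ge0.
  apply: (@le_lt_trans _ _
      (\int[@mixture R]_(y in `[0%R, 1%R]) ((- x)^-1 `^ p^-1)%R%:E)%E);
    last by rewrite integral_cst//= mixture_supp mule1 ltry.
  apply: ge0_le_integral => //.
  - exact: measurable_funTS.
  - move=> y /=; rewrite in_itv/= => /andP[y0 y1]; rewrite lee_fin.
    have [z0 zpi zn] := zE y y0 y1.
    rewrite /g/= ge0_ler_powR ?nnegrE ?fine_ge0 ?spike_ge0//.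
      by rewrite invr_ge0 oppr_ge0 ltW.
    rewrite -lee_fin fineK ?spike_fin_num// (le_trans (spike_le z0 zpi))//.
    by rewrite lee_fin zn lef_pV2 ?posrE; lra.
rewrite -lee_fin fineK//.
apply: (@le_trans _ _
    (\int[@mixture R]_(y in `[0%R, (width k / 2)%R])
      (density_height k `^ p^-1)%:E)%E).
  rewrite integral_cst//= EFinM lee_wpmul2l ?lee_fin ?powR_ge0//.
  exact: mixture_half_width.
apply: (@le_trans _ _
    (\int[@mixture R]_(y in `[0%R, (width k / 2)%R]) (g (x - y))%:E)%E).
  apply: ge0_le_integral => //.
  - by move=> y _; rewrite lee_fin powR_ge0.
  - exact: measurable_funTS.
  - move=> y /=; rewrite in_itv/= => /andP[y0 yk]; rewrite lee_fin.
    have y1 : y <= 1 by lra.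
    have [z0 zpi zn] := zE y y0 y1.
    rewrite /g/= ge0_ler_powR ?nnegrE ?fine_ge0 ?spike_ge0//.
      exact/ltW/density_height_gt0.
    rewrite -lee_fin fineK ?spike_fin_num// density_height_le_spike// zn; lra.
apply: ge0_subset_integral => //; first exact: measurable_funTS.
move=> y /=; rewrite !in_itv/= => /andP[-> yk] /=; lra.
Qed.

Lemma quadratic_exponent_unbounded (a b c M : R) : 0 < a ->
  exists k : nat, M < 2 `^ (a * k%:R ^+ 2 - b * k%:R - c).
Proof.
move=> a0; pose N := Num.bound `|M|.
have MN : M < 2 `^ N%:R.
  rewrite powR_mulrn// (le_lt_trans (ler_norm _))//.
  rewrite (lt_trans (archi_boundP (normr_ge0 M)))//.
  by rewrite -natrX ltr_nat ltn_expl.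
(* For k > L one has a k - b >= 1, hence a k^2 - b k >= k >= N + |c|, and the exponent is at least
   N. *)
pose L := (`|b| + 1) / a + N%:R + `|c|.
have L0 : 0 <= L by rewrite !addr_ge0// divr_ge0 ?addr_ge0// ltW.
exists (Num.bound L); have := archi_boundP L0; set k := (Num.bound L)%:R => Lk.
apply: (lt_le_trans MN); apply: ler_powR; first by rewrite ler1n.
have bk : `|b| + 1 <= a * k.
  rewrite mulrC -ler_pdivrMr// (le_trans _ (ltW Lk))// /L.
  by rewrite -addrA lerDl addr_ge0.
have kN : N%:R + `|c| <= k.
  rewrite (le_trans _ (ltW Lk))// /L -addrA lerDr divr_ge0 ?addr_ge0//.
  exact: ltW.
have k0 : 0 <= k by [].
have bb := ler_norm b; have cc := ler_norm c.
have : k * 1 <= k * (a * k - b) by rewrite ler_wpM2l//; lra.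
rewrite expr2; lra.
Qed.

Lemma weightE k : weight k = 2 `^ (- (k%:R + 1)).
Proof. by rewrite /weight exprVn -powR_invn// natr1. Qed.

Lemma widthE k : width k = 2 `^ (- k%:R ^+ 2).
Proof. by rewrite /width exprVn -powR_invn// natrX. Qed.

Lemma density_heightE k :
  density_height k = 2 `^ (k%:R ^+ 2 - k%:R - 1).
Proof.
rewrite /density_height weightE widthE -powRB ?pnatr_eq0 ?implybT//.
by congr powR; ring.
Qed.

Lemma lower_bound_unbounded (p r M : R) : 0 < p -> p < r -> exists k,
  M < (density_height k `^ p^-1 * (weight k / 2)) `^ r * (width k / 2).
Proof.
move=> p0 pr.
have a0 : 0 < r / p - 1 by rewrite subr_gt0 ltr_pdivlMr// mul1r.
(* These coefficients come from expanding r ((k^2 - k - 1)/p - (k + 2)) - k^2 - 1, the exponent of 2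
   in the lower bound. *)
have [k Mk] := quadratic_exponent_unbounded
  (r / p + r) (r / p + r + r + 1) M a0.
exists k; apply: (lt_le_trans Mk).
rewrite density_heightE weightE widthE -{4 6}(powRr1 (a := 2))//.
rewrite -!powRrM -!powRB ?pnatr_eq0 ?implybT// -!powRD ?pnatr_eq0 ?implybT//.
rewrite -powRrM -powRD ?pnatr_eq0 ?implybT//.
rewrite le_eqVlt; apply/orP; left; apply/eqP; congr powR; field.
by rewrite gt_eqF.
Qed.

Lemma haar_itv (a b : R) : - pi <= a -> a < b -> b <= pi ->
  haar R `[a, b[%classic = ((b - a) / (pi + pi))%:E.
Proof.
move=> pa ab bp; rewrite /haar/= /uniform_prob.
under eq_integral => x.
  rewrite inE/= in_itv/= => /andP[ax xb].
  rewrite /uniform_pdf ifT; last by apply/andP; split; lra.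
  over.
rewrite integral_cst//= lebesgue_measure_itv/= lte_fin ab -EFinD -EFinM opprK.
by rewrite mulrC.
Qed.

Lemma measurable_modulus (f : R -> R[i]) :
  measurable_fun [set: measurableTypeR R] (fun x => complex.Re (f x)) ->
  measurable_fun [set: measurableTypeR R] (fun x => complex.Im (f x)) ->
  measurable_fun [set: measurableTypeR R] (fun x => modulus (f x)).
Proof.
move=> mRe mIm.
have -> : (fun x => modulus (f x)) =
    (fun x => Num.sqrt (complex.Re (f x) ^+ 2 + complex.Im (f x) ^+ 2)).
  by apply/funext => x; rewrite /modulus; case: (f x).
have msqrt : measurable_fun [set: measurableTypeR R] (@Num.sqrt R).
  by apply: continuous_measurable_fun; exact: sqrt_continuous.
apply: (measurableT_comp msqrt).
by apply: measurable_funD; exact: measurable_funX.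
Qed.

(** On a probability space L^q is contained in L^r for r <= q. Take r = q if q is finite and r = p +
    1 otherwise, so that the case q = +oo is covered. *)
Lemma Lp_finite_exponent (p : R) (q : \bar R) (f : R -> R[i]) : 1 < p ->
  (p%:E < q)%E -> Lp q f -> exists2 r : R, p < r &
  (\int[haar R]_x (modulus (f x) `^ r)%:E < +oo)%E.
Proof.
move=> p1 pq [_ mRe mIm fq].
have mf := measurable_modulus mRe mIm.
have [r pr rq] : exists2 r : R, p < r & (r%:E <= q)%E.
  move: q pq {fq} => [q| |]; rewrite ?lte_fin//.
  - by move=> pq; exists q.
  - by move=> _; exists (p + 1); rewrite ?ltrDl// leey.
have q1 : (1 <= q)%E by rewrite (le_trans _ rq)// lee_fin; lra.
have r1 : (1 <= r%:E)%E by rewrite lee_fin; lra.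
exists r => //.
have : (fun x => modulus (f x)) \in Lfun (haar R) q.
  by rewrite inE; apply/andP; split; rewrite inE.
move=> /(Lfun_subset r1 q1 (fin_num_measure _ _ measurableT) rq) /andP[_].
rewrite inE => fr; have r0 : r != 0 by rewrite gt_eqF//; lra.
have powE x : ((modulus (f x) `^ r)%:E = `|(modulus (f x))%:E| `^ r)%E.
  rewrite abse_EFin ger0_norm ?poweR_EFin// /modulus.
  by case: (f x) => u v /=; rewrite sqrtr_ge0.
under eq_integral do rewrite powE.
have fr' : ('N[haar R]_r%:E[EFin \o (fun x => modulus (f x))] < +oo)%E := fr.
have := poweR_lty r fr'.
rewrite (poweR_Lnorm (haar R) (EFin \o (fun x => modulus (f x))) r0).
by [].
Qed.

Lemma not_hyperbounded_mixture : ~ hyperbounded (@mixture R).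
Proof.
move=> [p [q [p1 pq H]]]; have p0 : 0 < p by rewrite (lt_trans _ p1).
have Lq := H _ (Lp_test_function p1); have [_ mRe mIm _] := Lq.
have [r pr] := Lp_finite_exponent p1 pq Lq.
set f := convolution_operator _ _ in mRe mIm *; set I := (\int[_]_x _)%E => Iy.
have modRe x : complex.Re (f x) <= modulus (f x).
  rewrite /modulus; case: (f x) => u v /=; rewrite (le_trans (ler_norm _))//.
  by rewrite -sqrtr_sqr ler_wsqrtr// lerDl sqr_ge0.
have r0 : 0 < r by lra.
have mfr : measurable_fun [set: measurableTypeR R]
    (fun x => (modulus (f x) `^ r)%:E).
  apply/measurable_EFinP; apply: (measurableT_comp (measurable_powR r)).
  exact: measurable_modulus.
have I0 : (0 <= I)%E by apply: integral_ge0 => x _; rewrite lee_fin powR_ge0.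
have Ifin : I \is a fin_num by rewrite ge0_fin_numE.
(* The factor [pi + pi] undoes the normalization of [haar]. The contradiction is that [I] is at
   least [c] to the power r times the [haar] mass of [-h_k/2, 0[, for every k. *)
have [k] := lower_bound_unbounded (fine I * (pi + pi)) p0 pr.
have pp : 0 < pi + pi :> R by rewrite addr_gt0 ?pi_gt0.
apply/negP; rewrite -leNgt -(ler_pdivrMr _ _ pp).
set c := _ * (weight k / 2).
have c0 : 0 <= c.
  by rewrite mulr_ge0 ?powR_ge0// divr_ge0// weight_ge0.
rewrite -lee_fin fineK// -mulrA EFinM.
have wk := width_gt0 R k; have wk1 := width_le1 R k; have p2 := pi_ge2 R.
have -> : ((width k / 2 / (pi + pi))%:E =
    haar R `[(- (width k / 2))%R, 0%R[%classic)%E.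
  by rewrite haar_itv ?sub0r ?opprK//; lra.
rewrite -integral_cst//=.
apply: (@le_trans _ _
  (\int[haar R]_(x in `[(- (width k / 2))%R, 0%R[) (modulus (f x) `^ r)%:E)%E).
  apply: ge0_le_integral => //.
  - by move=> x _; rewrite lee_fin powR_ge0.
  - exact: measurable_funTS.
  - move=> x; rewrite /= in_itv/= => xk; rewrite lee_fin.
    have cf := le_trans (convolution_test_function_ge p0 xk) (modRe x).
    by rewrite ge0_ler_powR ?nnegrE ?(ltW r0)// (le_trans c0 cf).
apply: ge0_subset_integral => //.
by move=> x _; rewrite lee_fin powR_ge0.
Qed.

End not_hyperbounded.

Theorem proposition6p8 (R : realType) :
  exists nu : probability (measurableTypeR R) R,
    [/\ nu (circle R) = 1%E,
        nu `<< haar R,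
        ~ hyperbounded nu &
        (\esum_(n in [set n : int | n != 0%R])
           (modulus (fourier nu n) ^+ 2 / `|n|%:~R)%R%:E < +oo)%E].
Proof.
exists (@mixture R); split.
- exact: mixture_circle.
- exact: mixture_dominated.
- exact: not_hyperbounded_mixture.
- exact: fourier_sum_finite.
Qed.
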